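(* Let $K$ be a compact line. A family $(F_i)_{i\in I}$ in $\mathrm{NBV}(K)$ is weak*-null if and only if all of the following hold: (a) $(F_i)_{i\in I}$ is bounded in $\mathrm{NBV}(K)$; (b) $\lim_{i\in I}F_i(t)=0$ for all $t\in K^+$; (c) there exists $k\ge0$ such that $\sum_{t\in S}|F_i(t)|\le k\mod c_0(I)$ for every finite subset $S$ of $K$.
   Context: A compact line is a totally ordered set which is compact in its order topology. For $F:K\to\mathbb R$, $V(F)$ is the supremum over finite $t_0<\dots<t_n$ in $K$ of $\sum_j|F(t_{j+1})-F(t_j)|$ and $\Vert F\Vert_{\mathrm{BV}}=|F(\min K)|+V(F)$; $\mathrm{NBV}(K)$ is the Banach space of right-continuous maps of bounded variation with this norm. Each finite signed regular Borel measure $\mu$ on $K$ corresponds isometrically to $F_\mu(t)=\mu([\min K,t])\in\mathrm{NBV}(K)$, and this identifies $C(K)^*$ with $\mathrm{NBV}(K)$. For real families, $\lim_{i\in I}a_i=0$ means $\{i:|a_i|\ge\varepsilon\}$ is finite for each $\varepsilon>0$; $c_0(I)$ is the set of such families. $(F_i)_{i\in I}$ is weak*-null if $\lim_{i\in I}\int_Kf\,d\mu_i=0$ for all $f\in C(K)$, $\mu_i$ the measure with $F_{\mu_i}=F_i$. $K^+$ is the set of right-isolated points of $K$: $t=\max K$ or there is $s>t$ with $]t,s[=\emptyset$. For real families $(x_i),(y_i)$, ''$x_i\le y_i\mod c_0(I)$'' means there is $(z_i)\in c_0(I)$ with $x_i\le y_i+z_i$ for all $i$, i.e. $\{i:x_i\ge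 y_i+\varepsilon\}$ is finite for every $\varepsilon>0$. *)

(* Defs.v *)
From HB Require Import structures.
From mathcomp Require Import all_boot all_order all_algebra.
From mathcomp Require Import all_classical all_reals all_analysis.
Set Implicit Arguments. Unset Strict Implicit. Unset Printing Implicit Defensive.
Import Order.TTheory GRing.Theory Num.Theory numFieldNormedType.Exports.
Local Open Scope classical_set_scope.
Local Open Scope ring_scope.

Definition pointed_at {d} (K : orderTopologicalType d) (k0 : K) : Type := K.
HB.instance Definition _ d (K : orderTopologicalType d) (k0 : K) :=
  Choice.on (pointed_at k0).
HB.instance Definition _ d (K : orderTopologicalType d) (k0 : K) :=
  isPointed.Build (pointed_at k0) k0.

Section defs.
Context {d : Order.disp_t} (K : orderTopologicalType d) (k0 : K) (R : realType).

Definition Borel : measurableType _ :=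
  @g_sigma_algebraType (pointed_at k0) (@open K).

Definition var_sum (F : K -> R) (s : seq K) : R :=
  \sum_(p <- zip s (behead s)) `|F p.2 - F p.1|.

Definition variation (F : K -> R) : \bar R :=
  ereal_sup [set (var_sum F s)%:E | s in [set s : seq K | sorted <%O s]].

Definition bv_norm (m0 : K) (F : K -> R) : \bar R := (`|F m0|%:E + variation F)%E.

Definition right_continuous (F : K -> R) : Prop :=
  forall t : K, (F @ within [set x : K | (t <= x)%O] (nbhs t)) --> F t.

Definition NBV (F : K -> R) : Prop :=
  right_continuous F /\ (variation F < +oo)%E.

Definition regular (mu : {finite_measure set Borel -> \bar R}) : Prop :=
  forall A : set Borel, measurable A ->
    mu A = ereal_sup [set mu C | C in [set C : set K | compact C /\ C `<=` A]]
 /\ mu A = ereal_inf [set mu U | U in [set U : set K | open U /\ A `<=` U]].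

Definition distrib (mu : {finite_measure set Borel -> \bar R}) (t : K) : R :=
  fine (mu [set x : K | (x <= t)%O]).

Definition integ (mu : {finite_measure set Borel -> \bar R}) (f : K -> R) : R :=
  fine (\int[mu]_(x in [set: Borel]) (f x)%:E)%E.

Definition right_isolated (t : K) : Prop :=
  (forall x : K, (x <= t)%O) \/ exists s : K, (t < s)%O /\ forall x : K, ~ (t < x < s)%O.
End defs.

Definition c0lim {I : Type} {R : realType} (a : I -> R) : Prop :=
  forall e : R, 0 < e -> finite_set [set i | e <= `|a i|].

Definition le_mod_c0 {I : Type} {R : realType} (x y : I -> R) : Prop :=
  exists z : I -> R, c0lim z /\ forall i, x i <= y i + z i.

(* Main.v *)
(* Write L_i f for the integral of f against mu_i, and call a function regulated when it is a
   uniform limit of left-continuous step functions; on a compact line this covers the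
   continuous functions.  Riemann sums over a partition give |L_i h| <= sup |h| * |F_i|_BV for
   regulated h, and Urysohn functions together with regularity of the measures show that
   |F_i|_BV is the norm of L_i on C(K).

   Weak*-null => (a): uniform boundedness.  (b): the indicator of [min K, t] is continuous when t
   is right-isolated.  (c): for t_1 < ... < t_n choose continuous f_j equal to 1 up to t_j and to 0
   from t_{j+1} on.  The functions 1_{x <= t_j} - f_j have disjoint supports, so
   sum_j |F_i(t_j)| <= |F_i|_BV + sum_j |L_i f_j|, where the last sum tends to 0.

   Conversely, up to an error controlled by (a), L_i f is a Riemann sum, and Abel summation turns
   it into f(max K) F_i(max K) - sum_j F_i(t_j) (f(t_{j+1}) - f(t_j)).  The terms with t_j
   right-isolated tend to 0 by (b); in the others the increment of f is uniformly small by
   right-continuity, and (c) bounds the sum of the |F_i(t_j)|. *)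
Require Import Defs.
From HB Require Import structures.
From mathcomp Require Import all_boot all_order all_algebra.
From mathcomp Require Import all_classical all_reals all_analysis.
From mathcomp Require Import measurable_realfun lra.
Set Implicit Arguments. Unset Strict Implicit. Unset Printing Implicit Defensive.
Import Order.TTheory GRing.Theory Num.Theory numFieldNormedType.Exports.
Local Open Scope classical_set_scope.
Local Open Scope ring_scope.

(** * Families tending to zero *)

Section C0.
Context {I : Type} {R : realType}.
Implicit Types a b : I -> R.

Lemma c0lim_le a b : c0lim b -> (forall i, `|a i| <= `|b i|) -> c0lim a.
Proof.
move=> cb ab e e0; apply: sub_finite_set (cb _ e0) => i /= /le_trans; exact.
Qed.

Lemma c0lim0 : c0lim (fun _ : I => 0 : R).
Proof.
move=> e e0; rewrite (_ : [set _ | _] = set0) ?finite_set0//.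
by apply/seteqP; split => // i /=; rewrite normr0 leNgt e0.
Qed.

Lemma c0lim_norm a : c0lim a -> c0lim (fun i => `|a i|).
Proof. by move=> ca; apply: (c0lim_le ca) => i; rewrite normr_id. Qed.

Lemma c0limD a b : c0lim a -> c0lim b -> c0lim (fun i => a i + b i).
Proof.
move=> ca cb e e0; have e20 : 0 < e / 2 by rewrite divr_gt0.
apply: (@sub_finite_set _ _ ([set i | e / 2 <= `|a i|] `|` [set i | e / 2 <= `|b i|])).
  move=> i /= abi; have := ler_normD (a i) (b i).
  have [|ai] := leP (e / 2) `|a i|; first by left.
  have [|bi] := leP (e / 2) `|b i|; first by right.
  move=> ?; exfalso; lra.
by rewrite finite_setU; split; [exact: ca|exact: cb].
Qed.

Lemma c0limZ k a : c0lim a -> c0lim (fun i => k * a i).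
Proof.
move=> ca e e0; have k1 : 0 < `|k| + 1 by rewrite ltr_pwDr.
apply: sub_finite_set (ca (e / (`|k| + 1)) (divr_gt0 e0 k1)) => i /=.
rewrite normrM ler_pdivrMr// => /le_trans; apply.
by rewrite mulrC ler_wpM2l// lerDl.
Qed.

Lemma c0lim_sum (J : eqType) (s : seq J) (a : J -> I -> R) :
  (forall j, j \in s -> c0lim (a j)) -> c0lim (fun i => \sum_(j <- s) a j i).
Proof.
elim: s => [|j s IH] cs.
  by apply: (c0lim_le c0lim0) => i; rewrite big_nil.
have cj := cs j (mem_head _ _).
have {}IH : c0lim (fun i => \sum_(j <- s) a j i).
  by apply: IH => k ks; apply: cs; rewrite in_cons ks orbT.
by apply: (c0lim_le (c0limD cj IH)) => i; rewrite big_cons.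
Qed.

(** The correction [z] may depend on [e]. With [e / 2], the value [|a i|] can reach [e] only where
    [z i] is at least [e / 2], which happens finitely often. *)
Lemma c0lim_approx a :
  (forall e, 0 < e -> exists2 z, c0lim z & forall i, `|a i| <= e + z i) -> c0lim a.
Proof.
move=> H e e0; have e20 : 0 < e / 2 by rewrite divr_gt0.
have [z cz az] := H _ e20; apply: sub_finite_set (cz _ e20) => i /= ei.
have := az i; have := ler_norm (z i); lra.
Qed.

(** Only finitely many indices have [|a i| >= 1]; the bound is 1 plus the sum of the values taken
    there. *)
Lemma c0lim_bounded a : c0lim a -> exists B, forall i, `|a i| <= B.
Proof.
move=> /(_ 1 ltr01) /(finite_image (fun i => `|a i|)) /finite_seqP[s sE].
exists (1 + \sum_(x <- s) `|x|) => i.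
have s0 (u : seq R) : 0 <= \sum_(x <- u) `|x| by apply: sumr_ge0.
have [ai|ai] := leP 1 `|a i|; last by rewrite (le_trans (ltW ai))// lerDl.
have : [set` s] `|a i| by rewrite -sE /=; exists i.
move=> /= ais; rewrite (big_rem _ ais)/= normr_id.
by have := s0 (rem `|a i| s); lra.
Qed.

End C0.

(** * Separation and compactness on a line; regulated functions *)

Section Line.
Context {R : realType} {d : Order.disp_t} {K : orderTopologicalType d}.
Implicit Types (f g h : K -> R) (s t x y : K) (l : seq K).

Definition lower_ind (t x : K) : R := (x <= t)%O%:R.

Lemma urysohn_line (A B : set K) : compact [set: K] ->
  closed A -> closed B -> A `&` B = set0 ->
  exists f, [/\ continuous f, forall x, 0 <= f x <= 1,
    forall x, A x -> f x = 1 & forall x, B x -> f x = 0].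
Proof.
move=> cK cA cB AB.
have /(@normal_separatorP R) nK := compact_normal order_hausdorff cK.
have BA : B `&` A = set0 by rewrite setIC.
have /(@uniform_separatorP _ R)[f [cf f01 f0 f1]] := nK _ _ cB cA BA.
exists f; split => // x.
- have /= : range f (f x) by exists x.
  by move/f01; rewrite /= in_itv.
- by move=> Ax; apply: f1; exists x.
- by move=> Bx; apply: f0; exists x.
Qed.

Lemma urysohn_lt s t : compact [set: K] -> (s < t)%O ->
  exists f, [/\ continuous f, forall x, 0 <= f x <= 1,
    forall x, (x <= s)%O -> f x = 1 & forall x, (t <= x)%O -> f x = 0].
Proof.
move=> cK st.
have [|f [cf f01 f1 f0]] := @urysohn_line `]-oo, s] `[t, +oo[ cK
  (@lray_closed _ _ _) (@rray_closed _ _ _).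
  apply/seteqP; split => // x /=; rewrite !in_itv/= andbT => -[xs tx].
  by have := lt_le_trans st (le_trans tx xs); rewrite ltxx.
exists f; split; [exact: cf|exact: f01| |] => x xs; [apply: f1|apply: f0];
  by rewrite /= in_itv/= ?andbT.
Qed.

(** Compactness as a local-to-global principle: finite lists that work locally can be merged into
    one. The proof applies the near-covering form of compactness to the filter of lists that contain
    a given list. *)
Lemma compact_seq_cover (P : seq K -> K -> Prop) : compact [set: K] ->
  (forall l l' x, {subset l <= l'} -> P l x -> P l' x) ->
  (forall x, exists l, \forall y \near x, P l y) ->
  exists l, forall x, P l x.
Proof.
move=> cK mP locP.
pose F : set_system (seq K) :=
  filter_from [set: seq K] (fun l => [set l' | {subset l <= l'}]).
have FF : Filter F.
  apply: filter_from_filter; first by exists [::].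
  move=> l1 l2 _ _; exists (l1 ++ l2) => // l' sl /=.
  by split => x xl; apply: sl; rewrite mem_cat xl ?orbT.
move/compact_near_coveringP : cK => /(_ _ F P FF)[x _|l _ Hl].
  have [l Hl] := locP x; exists ([set y | P l y], [set l' | {subset l <= l'}]).
    by split => //; exists l.
  by move=> [y l'] /= [Py sl]; exact: mP Py.
by exists l => x; exact: (Hl l).
Qed.

Lemma compact_line_max (m0 : K) : compact [set: K] ->
  exists M : K, forall x, (x <= M)%O.
Proof.
move=> cK; apply: contrapT => /forallNP noM.
have [|x|l Hl] := @compact_seq_cover (fun l x => exists2 a, a \in l & (x < a)%O) cK.
- by move=> l l' x sl [a al xa]; exists a => //; exact: sl.
- have /existsNP[a /negP] := noM x; rewrite -ltNge => xa; exists [:: a].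
  have : nbhs x [set` `]-oo, a[%O].
    by apply: open_nbhs_nbhs; split; [exact: lray_open|rewrite /= in_itv].
  by apply: filterS => y /=; rewrite in_itv/= => ya; exists a; rewrite ?mem_head.
(* The maximum of the list cannot lie strictly below a member of the list; [m0] is the default of
   the maximum. *)
have [a al] := Hl (\big[Order.max/m0]_(a <- l) a).
suff : (a <= \big[Order.max/m0]_(a <- l) a)%O by rewrite leNgt => /negbTE ->.
exact: le_bigmax_seq.
Qed.

(* Functions that are uniformly approximable by left-continuous step functions. *)
Definition regulated h := forall e, 0 < e -> exists l, forall y x, (x <= y)%O ->
  (forall p, p \in l -> ~~ (x <= p < y)%O) -> `|h x - h y| <= e.

Lemma regulatedD f g : regulated f -> regulated g ->
  regulated (fun x => f x + g x).
Proof.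
move=> rf rg e e0; have e20 : 0 < e / 2 by rewrite divr_gt0.
have [lf Hf] := rf _ e20; have [lg Hg] := rg _ e20.
exists (lf ++ lg) => y x xy H.
have /(Hf _ _ xy) : forall p, p \in lf -> ~~ (x <= p < y)%O.
  by move=> p pl; apply: H; rewrite mem_cat pl.
have /(Hg _ _ xy) : forall p, p \in lg -> ~~ (x <= p < y)%O.
  by move=> p pl; apply: H; rewrite mem_cat pl orbT.
have := ler_normD (f x - f y) (g x - g y).
rewrite (_ : f x - f y + (g x - g y) = f x + g x - (f y + g y)); last by lra.
lra.
Qed.

Lemma regulatedZ k f : regulated f -> regulated (fun x => k * f x).
Proof.
move=> rf e e0; have k1 : 0 < `|k| + 1 by rewrite ltr_pwDr.
have [l H] := rf _ (divr_gt0 e0 k1); exists l => y x xy /(H _ _ xy).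
rewrite -mulrBr normrM ler_pdivlMr// => /(le_trans _); apply.
by rewrite mulrC ler_wpM2l// lerDl.
Qed.

Lemma regulated_lower_ind t : regulated (lower_ind t).
Proof.
move=> e e0; exists [:: t] => y x xy /(_ t); rewrite mem_head => /(_ isT).
rewrite /lower_ind; case: (leP y t) => yt.
  by rewrite (le_trans xy yt) subrr normr0 ltW.
by rewrite andbT => /negbTE ->; rewrite subrr normr0 ltW.
Qed.

Lemma regulated_continuous f : compact [set: K] -> continuous f -> regulated f.
Proof.
move=> cK cf e e0; have e20 : 0 < e / 2 by rewrite divr_gt0.
apply: compact_seq_cover cK _ _ => [l l' y sl Hl x xy H|t].
  by apply: Hl => // p pl; apply: H; exact: sl.
have : nbhs t [set x | `|f t - f x| < e / 2].
  by have /cvgrPdist_lt/(_ _ e20) := cf t.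
rewrite itv_nbhsE => -[/= i [oi ti] iU].
have ei u v : u \in i -> v \in i -> `|f u - f v| <= e.
  move=> /iU /= fu /iU /= fv; have := ler_normB (f t - f v) (f t - f u).
  rewrite (_ : f t - f v - (f t - f u) = f u - f v); last by lra.
  lra.
(* Listing the left endpoint of [i], if there is one, keeps [x] inside [i] as soon as [y] is there
   and [x <= y]. *)
exists (if i is Interval (BSide _ a) _ then [:: a] else [::]).
have : nbhs t [set` i].
  by apply: open_nbhs_nbhs; split => //; exact: itv_open_ends_open.
apply: filterS => y /= yi x xy xl; apply: ei => //.
case: i oi yi xl {iU ti} => [[[]a|[]] [[]b|[]]] //= _;
  rewrite !in_itv/= ?andbT => yi xl //;
  try (have := xl a; rewrite mem_head => /(_ isT) {}xl);
  try (by move: yi => /andP[ay yb]; move: xl; rewrite ay andbT -ltNge => ->;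
    rewrite (le_lt_trans xy yb));
  try (by rewrite (le_lt_trans xy yi));
  by move: xl; rewrite yi andbT -ltNge.
Qed.

End Line.

(** * Integration of admissible functions against a difference of measures *)

Section Pairing.
Context {R : realType} {d : Order.disp_t} {K : orderTopologicalType d} {m0 : K}.
Implicit Types (f g h : K -> R) (s t x y : K) (l : seq K).
Implicit Types mu : {finite_measure set (Borel m0) -> \bar R}.

Lemma open_Borel (U : set K) : open U -> measurable (U : set (Borel m0)).
Proof. by move=> oU; exact: sub_sigma_algebra. Qed.

Lemma lower_Borel t : measurable ([set x | (x <= t)%O] : set (Borel m0)).
Proof.
rewrite -[X in measurable X]setCK; apply: measurableC; apply: open_Borel.
rewrite openC (_ : [set x | _] = `]-oo, t]%classic); first exact: lray_closed.
by apply/seteqP; split => x /=; rewrite in_itv.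
Qed.

Lemma continuous_Borel f : continuous f ->
  measurable_fun [set: Borel m0] (f : Borel m0 -> R).
Proof.
move=> /continuousP cf; apply: (measurability _ (RGenOpens.measurableE R)).
move=> _ [_ [a [b ->] <-]]; rewrite setTI; apply: open_Borel.
exact/cf/interval_open.
Qed.

Lemma lower_ind_indic t :
  lower_ind t = \1_[set x : Borel m0 | (x <= t)%O] :> (K -> R).
Proof. by apply/funext => x; rewrite /lower_ind indicE mem_setE. Qed.

Lemma lower_ind_Borel t :
  measurable_fun [set: Borel m0] (lower_ind t : Borel m0 -> R).
Proof. by rewrite lower_ind_indic; apply: measurable_indic; exact: lower_Borel. Qed.

(** A class closed under linear combinations that contains the indicators [lower_ind t] and, on a
    compact line, the continuous functions. Its members are integrable and can be approximated by
    staircases. *)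
Definition admissible h := [/\ measurable_fun [set: Borel m0] (h : Borel m0 -> R),
  exists c, forall x, `|h x| <= c & regulated h].

Lemma admissibleD f g : admissible f -> admissible g ->
  admissible (fun x => f x + g x).
Proof.
move=> [mf [cf bf] rf] [mg [cg bg] rg]; split.
- exact: measurable_funD.
- exists (cf + cg) => x; rewrite (le_trans (ler_normD _ _))//.
  by rewrite lerD.
- exact: regulatedD.
Qed.

Lemma admissibleZ k f : admissible f -> admissible (fun x => k * f x).
Proof.
move=> [mf [cf bf] rf]; split.
- by apply: measurable_funM => //; exact: measurable_cst.
- by exists (`|k| * cf) => x; rewrite normrM ler_wpM2l.
- exact: regulatedZ.
Qed.

Lemma admissible_lower_ind t : admissible (lower_ind t).
Proof.
split; last 1 first.
- exact: regulated_lower_ind.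
- exact: lower_ind_Borel.
- by exists 1 => x; rewrite normr_nat lern1; case: (x <= t)%O.
Qed.

Lemma admissible_continuous f : compact [set: K] -> continuous f -> admissible f.
Proof.
move=> cK cf; split; [exact: continuous_Borel| |exact: regulated_continuous].
have nf : {within [set: K], continuous (fun x => `|f x|)}.
  apply: continuous_subspaceT => x; exact: (cvg_norm (cf x)).
have [c _ Hc] := compact_EVT_max (ex_intro _ m0 I) cK nf.
by exists `|f c| => x; apply: Hc; rewrite inE.
Qed.

Lemma integrable_admissible mu h : admissible h ->
  mu.-integrable setT (EFin \o (h : Borel m0 -> R)).
Proof.
move=> [mh [c bh] _]; apply: measurable_bounded_integrable => //.
  by rewrite ltey_eq fin_num_measure.
exists c; split; first exact: num_real.
by move=> e ce x _; exact: le_trans (bh x) (ltW ce).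
Qed.

Lemma integD mu f g : admissible f -> admissible g ->
  integ mu (fun x => f x + g x) = integ mu f + integ mu g.
Proof. by move=> Af Ag; apply: RintegralD => //; exact: integrable_admissible. Qed.

Lemma integZ mu k f : admissible f -> integ mu (fun x => k * f x) = k * integ mu f.
Proof. by move=> Af; apply: RintegralZl => //; exact: integrable_admissible. Qed.

Lemma le_integ mu f g : admissible f -> admissible g ->
  (forall x, f x <= g x) -> integ mu f <= integ mu g.
Proof. by move=> Af Ag fg; apply: le_Rintegral => //; exact: integrable_admissible. Qed.

Lemma integ_lower_ind mu t : integ mu (lower_ind t) = distrib mu t.
Proof.
rewrite /integ /distrib lower_ind_indic integral_indic ?setIT//.
exact: lower_Borel.
Qed.

Lemma normr_integ_le mu h c : admissible h -> (forall x, `|h x| <= c) ->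
  `|integ mu h| <= c * fine (mu setT).
Proof.
move=> Ah hc; apply: (@le_trans _ _ (\int[mu]_(x in [set: Borel m0]) c)).
  have ih := integrable_admissible mu Ah.
  apply: (le_trans (le_normr_Rintegral _ ih)) => //.
  apply: le_Rintegral => //.
  - exact: integrable_norm ih.
  - exact: finite_measure_integrable_cst.
by rewrite Rintegral_cst.
Qed.

Context (mp mn : {finite_measure set (Borel m0) -> \bar R}).

(** The integral against the signed measure [mp - mn], that is, the functional L_i of the
    overview. *)
Definition pairing h : R := integ mp h - integ mn h.

Lemma pairingD f g : admissible f -> admissible g ->
  pairing (fun x => f x + g x) = pairing f + pairing g.
Proof. by move=> Af Ag; rewrite /pairing !integD//; lra. Qed.

Lemma pairingZ k f : admissible f ->
  pairing (fun x => k * f x) = k * pairing f.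
Proof. by move=> Af; rewrite /pairing !integZ//; lra. Qed.

Lemma admissible_pairing_sum (J : Type) (r : seq J) (a : J -> R) (f : J -> K -> R) :
  (forall j, admissible (f j)) ->
  admissible (fun x => \sum_(j <- r) a j * f j x) /\
  pairing (fun x => \sum_(j <- r) a j * f j x) = \sum_(j <- r) a j * pairing (f j).
Proof.
move=> Af; elim: r => [|j r [IHa IHp]].
  (* The empty sum is written as a multiple of an indicator, so that it is admissible and pairs to
     0. *)
  rewrite (_ : (fun x => _) = (fun x => 0 * lower_ind m0 x)); last first.
    by apply/funext => x; rewrite big_nil mul0r.
  have A0 := admissible_lower_ind m0.
  by rewrite big_nil pairingZ// mul0r; split=> //; exact: admissibleZ.
rewrite (_ : (fun x => _) =
  (fun x => a j * f j x + \sum_(j <- r) a j * f j x)); last first.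
  by apply/funext => x; rewrite big_cons.
have Aj := admissibleZ (a j) (Af j).
by rewrite pairingD// pairingZ// IHp big_cons; split=> //; exact: admissibleD.
Qed.

End Pairing.

(** * Partitions, Riemann sums and the upper bound by the variation norm *)

Lemma mem_zip (T : eqType) (s t : seq T) (p : T * T) :
  p \in zip s t -> p.1 \in s /\ p.2 \in t.
Proof.
elim: s t => [|x s IH] [|y t]//=; rewrite !inE => /predU1P[->|/IH[-> ->]].
  by rewrite !eqxx.
by rewrite !orbT.
Qed.

Section Riemann.
Context {R : realType} {d : Order.disp_t} {K : orderTopologicalType d}.
Implicit Types (f g h F : K -> R) (s t x y : K) (l : seq K).

Lemma path_lt_last t l : path <%O t l -> forall x, x \in t :: l -> (x <= last t l)%O.
Proof.
elim: l t => [|u l IH] t /=; first by move=> _ x; rewrite inE => /eqP ->.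
move=> /andP[tu ul] x; rewrite inE => /predU1P[->|]; last exact: IH.
by apply: le_trans (ltW tu) _; apply: IH ul _ _; exact: mem_head.
Qed.

Lemma path_lt_zip t l : path <%O t l -> forall p, p \in zip (t :: l) l ->
  (p.1 < p.2)%O /\ forall q, q \in t :: l -> (q <= p.1)%O \/ (p.2 <= q)%O.
Proof.
elim: l t => [|u l IH] t //= /andP[tu ul] p.
have ul' q : q \in u :: l -> (u <= q)%O.
  rewrite inE => /predU1P[->//|ql].
  by have /allP/(_ _ ql)/ltW := order_path_min lt_trans ul.
rewrite inE => /predU1P[-> /=|pl]; last have [p12 Hp] := IH _ ul _ pl.
  by split => // q; rewrite inE => /predU1P[->|/ul']; [left|right].
split => // q; rewrite inE => /predU1P[->|]; last exact: Hp.
left; apply: le_trans (ltW tu) (ul' _ _).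
by have [] := mem_zip pl.
Qed.

(** For increasing [t :: l] this is the left-continuous step function with value [h t] up to [t],
    [h p.2] on each interval from [p.1] (excluded) to [p.2] (included), and 0 beyond the last point.
    The factor [-1] presents it as a linear combination of indicators. *)
Definition staircase h t l x : R :=
  h t * lower_ind t x +
  \sum_(p <- zip (t :: l) l) h p.2 * (lower_ind p.2 x + -1 * lower_ind p.1 x).

(** The Riemann-Stieltjes sum with right endpoints as tags, which is the pairing with the
    staircase. *)
Definition riemann_sum h F t l : R :=
  h t * F t + \sum_(p <- zip (t :: l) l) h p.2 * (F p.2 - F p.1).

Lemma riemann_sum_abel h F t l : riemann_sum h F t l =
  h (last t l) * F (last t l) - \sum_(p <- zip (t :: l) l) (h p.2 - h p.1) * F p.1.
Proof.
rewrite /riemann_sum; elim: l t => [|u l IH] t; first by rewrite !big_nil; lra.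
by have := IH u; rewrite /= !big_cons/=; lra.
Qed.

Lemma normr_riemann_sum_le h F t l c : (forall x, `|h x| <= c) ->
  `|riemann_sum h F t l| <= c * (`|F t| + var_sum F (t :: l)).
Proof.
move=> hc; rewrite mulrDr; apply: (le_trans (ler_normD _ _)).
rewrite normrM lerD ?ler_wpM2r//= (le_trans (ler_norm_sum _ _ _))//.
by rewrite mulr_sumr ler_sum// => p _; rewrite normrM ler_wpM2r.
Qed.

(** The point [y] is the first partition point not below [x]; the last clause is the hypothesis
    under which [regulated] compares [h x] with [h y]. *)
Lemma staircaseP h t l : path <%O t l -> forall x, (x <= last t l)%O ->
  exists y, [/\ y \in t :: l, (x <= y)%O, staircase h t l x = h y &
    forall p, p \in t :: l -> ~~ (x <= p < y)%O].
Proof.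
rewrite /staircase.
have lt t' x : (x <= t')%O -> lower_ind t' x = 1 :> R by rewrite /lower_ind => ->.
have gt t' x : (t' < x)%O -> lower_ind t' x = 0 :> R.
  by rewrite /lower_ind leNgt => ->.
elim: l t => [|u l IH] t /=.
  move=> _ x xt; exists t; rewrite mem_head big_nil lt// addr0 mulr1.
  by split => // p; rewrite inE => /eqP ->; rewrite ltxx andbF.
move=> /andP[tu ul] x xl; have [y [yl xy hy yP]] := IH _ ul _ xl.
have [xt|tx] := leP x t.
  exists t; split; rewrite ?mem_head//; last first.
    move=> p; rewrite inE => /predU1P[->|pl]; first by rewrite ltxx andbF.
    rewrite negb_and -!leNgt; apply/orP; right; apply: le_trans (ltW tu) _.
    move: pl; rewrite inE => /predU1P[->//|pl].
    by have /allP/(_ _ pl)/ltW := order_path_min lt_trans ul.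
  have xu := le_trans xt (ltW tu).
  (* To the left of [t] all indicators equal 1, so every difference vanishes and [h t] remains. *)
  rewrite big_cons/= big1_seq; first by rewrite !lt//; lra.
  move=> p /= pl; have [p1 p2] : (u <= p.1)%O /\ (u <= p.2)%O.
    have ul' q : q \in u :: l -> (u <= q)%O.
      rewrite inE => /predU1P[->//|ql].
      by have /allP/(_ _ ql)/ltW := order_path_min lt_trans ul.
    have [p1l p2l] := mem_zip pl.
    by rewrite /= !ul'// inE p2l orbT.
  by rewrite !lt ?(le_trans xu)//; lra.
exists y; split => //; first by rewrite inE yl orbT.
- by rewrite -hy big_cons /= gt//; have := gt t x tx; lra.
- move=> p; rewrite inE => /predU1P[->|]; last exact: yP.
  by rewrite leNgt tx.
Qed.

(** The partition is the sorted list of the points given by [regulated], with the minimum and the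
    maximum of the line added. *)
Lemma regulated_partition (m0 : K) h e : compact [set: K] -> (forall x, (m0 <= x)%O) ->
  regulated h -> 0 < e ->
  exists l, [/\ path <%O m0 l, forall x, (x <= last m0 l)%O,
    forall x, `|h x - staircase h m0 l x| <= e &
    forall p, p \in zip (m0 :: l) l ->
      forall x, (p.1 < x)%O -> (x <= p.2)%O -> `|h x - h p.2| <= e].
Proof.
move=> cK hm0 rh e0; have [M HM] := compact_line_max m0 cK.
have [P HP] := rh _ e0; pose s := sort <=%O (undup (m0 :: M :: P)).
have mem_s x : (x \in s) = (x \in m0 :: M :: P) by rewrite mem_sort mem_undup.
have : sorted <%O s by rewrite lt_sorted_uniq_le sort_uniq undup_uniq sort_le_sorted.
have : m0 \in s by rewrite mem_s mem_head.
have : M \in s by rewrite mem_s !inE eqxx orbT.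
have sP x y : (x <= y)%O -> (forall p, p \in s -> ~~ (x <= p < y)%O) -> `|h x - h y| <= e.
  by move=> xy H; apply: HP => // p pP; apply: H; rewrite mem_s !inE pP !orbT.
clearbody s => {mem_s}.
case: s sP => [//|u l] sP Ms ms us.
have um : u = m0.
  apply/eqP; rewrite eq_le hm0 andbT.
  move: ms; rewrite inE => /predU1P[->//|ml].
  by have /allP/(_ _ ml)/ltW := order_path_min lt_trans us.
move: us sP Ms; rewrite um /= => us sP Ms {ms um}.
have lastM x : (x <= last m0 l)%O by apply: le_trans (HM x) (path_lt_last us _).
exists l; split => //.
- move=> x; have [y [yl xy -> yP]] := staircaseP h us (lastM x); exact: sP.
- move=> p pl x p1x xp2; apply: sP => // q ql.
  have [_ /(_ _ ql)[qp|pq]] := path_lt_zip us pl.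
    by rewrite [(x <= q)%O]leNgt (le_lt_trans qp p1x).
  by rewrite [(q < _)%O]ltNge pq andbF.
Qed.

Lemma bv_normP (m0 : K) F (B : R) : (bv_norm m0 F <= B%:E)%E <->
  forall l, sorted <%O l -> `|F m0| + var_sum F l <= B.
Proof.
rewrite /bv_norm -leeBrDl//; split=> [FB l sl|H].
  rewrite -lerBrDl -lee_fin EFinB; apply: le_trans FB.
  by apply: ereal_sup_ubound; exists l.
apply: ge_ereal_sup => _ [l /= sl <-].
by rewrite -EFinB lee_fin lerBrDl; exact: H.
Qed.

Section BVPairing.
Context {m0 : K} (mp mn : {finite_measure set (Borel m0) -> \bar R}) (F : K -> R).
Context (FE : forall t, F t = distrib mp t - distrib mn t).

Lemma pairing_lower_ind t : pairing mp mn (lower_ind t) = F t.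
Proof. by rewrite /pairing !integ_lower_ind FE. Qed.

Lemma admissible_pairing_staircase h t l : admissible (m0 := m0) (staircase h t l) /\
  pairing mp mn (staircase h t l) = riemann_sum h F t l.
Proof.
have Ai u : admissible (R := R) (m0 := m0) (lower_ind u) := admissible_lower_ind u.
have Ap (p : K * K) : admissible (R := R) (m0 := m0)
    (fun x => lower_ind p.2 x + -1 * lower_ind p.1 x).
  by apply: admissibleD => //; exact: admissibleZ.
have [As ps] := admissible_pairing_sum mp mn (zip (t :: l) l) (fun p => h p.2) Ap.
have At := admissibleZ (h t) (Ai t).
split; first exact: admissibleD.
rewrite [LHS]pairingD// pairingZ// ps pairing_lower_ind; congr (_ + _).
apply: eq_bigr => p _; rewrite pairingD//; last exact: admissibleZ.
by rewrite pairingZ// !pairing_lower_ind mulN1r.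
Qed.

(** The staircase of [h] pairs to a Riemann sum, at most [c * B]. The remainder is uniformly below
    [e / (T + 1)], with [T] the total mass of both measures, and so contributes at most [e]; hence
    [T] does not enter the bound. *)
Lemma normr_pairing_le h c (B : R) : compact [set: K] -> (forall x, (m0 <= x)%O) ->
  admissible (m0 := m0) h -> (forall x, `|h x| <= c) -> (bv_norm m0 F <= B%:E)%E ->
  `|pairing mp mn h| <= c * B.
Proof.
move=> cK hm0 Ah hc /bv_normP FB; apply/ler_addgt0Pr => e e0.
pose T := fine (mp setT) + fine (mn setT).
have T0 : 0 <= T by rewrite addr_ge0// fine_ge0.
have T1 : 0 < T + 1 by lra.
have [_ _ rh] := Ah.
have [l [ml _ hl _]] := regulated_partition cK hm0 rh (divr_gt0 e0 T1).
have [As ps] := admissible_pairing_staircase h m0 l.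
have As' := admissibleZ (-1) As.
have Ad := admissibleD Ah As'.
have -> : pairing mp mn h = riemann_sum h F m0 l +
    pairing mp mn (fun x => h x + -1 * staircase h m0 l x).
  by rewrite pairingD// pairingZ// ps; lra.
have hl' x : `|h x + -1 * staircase h m0 l x| <= e / (T + 1) by rewrite mulN1r.
have := normr_integ_le mp Ad hl'; have := normr_integ_le mn Ad hl'.
have c0 : 0 <= c by exact: le_trans (normr_ge0 _) (hc m0).
have := ler_wpM2l c0 (FB (m0 :: l) ml).
have := normr_riemann_sum_le F m0 l hc.
have : e / (T + 1) * T <= e.
  by rewrite mulrAC ler_pdivrMr// ler_pM2l//; lra.
rewrite /T mulrDr /pairing.
set a := integ mp _; set b := integ mn _.
have := ler_normB a b; have := ler_normD (riemann_sum h F m0 l) (a - b).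
lra.
Qed.

End BVPairing.
End Riemann.

(** * A uniform boundedness principle for functionals on continuous functions *)

Section UniformBoundedness.
Context {R : realType} {T : topologicalType}.

(** The intervals with centre [u n] and radius 3/2 times 3^-n, the tail of the geometric series, are
    nested; the supremum of their left ends lies in all of them. *)
Lemma geometric_cauchy_limit (u : nat -> R) :
  (forall n, `|u n.+1 - u n| <= (3 ^+ n)^-1) ->
  exists v, forall n, `|v - u n| <= 3 / 2 * (3 ^+ n)^-1.
Proof.
move=> du; pose r n : R := (3 ^+ n)^-1.
have rS n : r n = 3 * r n.+1 by rewrite /r exprS invfM mulrA mulfV ?mul1r.
have r0 n : 0 < r n by rewrite /r invr_gt0 exprn_gt0.
pose a n := u n - 3 / 2 * r n; pose b n := u n + 3 / 2 * r n.
have aS : {homo a : n m / (n <= m)%N >-> n <= m}.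
  apply: homo_leq => [x //|y x z|n]; first exact: le_trans.
  by have := du n; rewrite ler_norml /a -/(r n) => /andP[+ _]; have := rS n; lra.
have bS : {homo b : n m / (n <= m)%N >-> m <= n}.
  apply: homo_leq => [x //|y x z xy yz|n]; first exact: le_trans yz xy.
  by have := du n; rewrite ler_norml /b -/(r n) => /andP[_]; have := rS n; lra.
have ab n m : a n <= b m.
  apply: (le_trans (aS _ _ (leq_maxl n m))); apply: le_trans (bS _ _ (leq_maxr n m)).
  by rewrite /a /b; have := r0 (maxn n m); lra.
have hs : has_sup (range a).
  by split; [exists (a 0), 0|exists (b 0) => _ [n _ <-]].
exists (sup (range a)) => n; rewrite ler_norml -/(r n).
have an : a n <= sup (range a) by apply: (sup_upper_bound hs); exists n.
have bn : sup (range a) <= b n.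
  by apply: ge_sup; [exists (a 0), 0|move=> _ [m _ <-]].
by move: an bn; rewrite /a /b => *; apply/andP; split; lra.
Qed.

Lemma exists_geometric_lt (e : R) : 0 < e -> exists n, (3 ^+ n)^-1 < e.
Proof.
move=> e0; have [n _ ne] : \forall n \near \oo, e^-1 < n%:R.
  exact: nbhs_infty_gtr.
exists n; rewrite -[e]invrK ltf_pV2 ?posrE ?invr_gt0 ?exprn_gt0//.
apply: lt_trans (ne n (leqnn n)) _.
by rewrite -natrX ltr_nat ltn_expl.
Qed.

Lemma continuous_geometric_limit (x_ : nat -> T -> R) (x : T -> R) :
  (forall n, continuous (x_ n)) ->
  (forall n t, `|x t - x_ n t| <= 3 / 2 * (3 ^+ n)^-1) -> continuous x.
Proof.
move=> cx xx t; apply/cvgrPdist_lt => e e0.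
(* Each of the two approximation errors is then at most [e / 4], which leaves room for the [e / 3]
   from the continuity of [x_ n]. *)
have [n ne] : exists n, (3 ^+ n)^-1 < e / 6 by apply: exists_geometric_lt; lra.
have e30 : 0 < e / 3 by lra.
have /cvgrPdist_lt/(_ _ e30) := cx n t; apply: filterS => y.
rewrite -[x t - x y](_ : (x t - x_ n t) + (x_ n t - x_ n y) - (x y - x_ n y) = _);
  last by lra.
have := ler_normB ((x t - x_ n t) + (x_ n t - x_ n y)) (x y - x_ n y).
have := ler_normD (x t - x_ n t) (x_ n t - x_ n y).
by have := xx n t; have := xx n y; lra.
Qed.

(* Sokal's elementary gliding hump: at stage n the iterate moves by at most 3^-n,
   the later moves add up to 3^-n / 2, and so cannot cancel a value that is at least
   (3/4) 3^-n times the norm of the chosen functional. *)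
Lemma uniform_boundedness (I : Type) (Phi : I -> (T -> R) -> R) (N : I -> R) :
  (forall i (f g : T -> R) k, continuous f -> continuous g ->
     Phi i (fun x => f x + k * g x) = Phi i f + k * Phi i g) ->
  (forall i (f : T -> R) (c : R), continuous f -> (forall x, `|f x| <= c) -> `|Phi i f| <= c * N i) ->
  (forall i r, r < N i ->
     exists f : T -> R, [/\ continuous f, forall x, `|f x| <= 1 & r <= Phi i f]) ->
  (forall f : T -> R, continuous f -> exists B : R, forall i, `|Phi i f| <= B) ->
  exists M, forall i, N i <= M.
Proof.
move=> linP PhiN NPhi bdP; apply: contrapT => /forallNP unb.
have cD (f g : T -> R) k : continuous f -> continuous g -> continuous (fun x => f x + k * g x : R).
  by move=> cf cg t; apply: cvgD; [exact: cf|apply: cvgMr; exact: cg].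
have r0 n : 0 < (3 ^+ n)^-1 :> R by rewrite invr_gt0 exprn_gt0.
have step (p : nat * (T -> R)) : exists q : (T -> R) * I, continuous p.2 ->
    [/\ continuous q.1, forall t, `|q.1 t - p.2 t| <= (3 ^+ p.1)^-1 &
      p.1%:R + (3 ^+ p.1)^-1 / 2 * N q.2 <= `|Phi q.2 q.1| ].
  (* This size gives n <= 3^-n N_i / 4, so a value of 3/4 times 3^-n N_i covers both terms required
     of the new iterate. The summand 1 makes N_i positive, whence 3/4 N_i < N_i. *)
  case: p => n x /=; have /existsNP[i /negP] := unb (4 * n%:R * 3 ^+ n + 1).
  rewrite -ltNge => Ni.
  have n0 : 0 <= 4 * n%:R * 3 ^+ n :> R by rewrite !mulr_ge0// exprn_ge0.
  have [|f [cf f1 Pf]] := NPhi i (3 / 4 * N i); first by lra.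
  pose r : R := (3 ^+ n)^-1.
  have nr : 4 * n%:R <= r * N i.
    rewrite [r * _]mulrC /r ler_pdivlMr ?exprn_gt0//; lra.
  (* The step must be a total function for [choice]; at a discontinuous [x] its value is
     arbitrary. *)
  have [cx|ncx] := pselect (continuous x); last by exists (x, i).
  have Pp := linP i _ _ r cx cf; have Pm := linP i _ _ (- r) cx cf.
  have rf t : `|r * f t| <= r.
    by rewrite normrM gtr0_norm ?r0// ler_piMr// ltW// r0.
  have rPf : r * (3 / 4 * N i) <= r * Phi i f by rewrite ler_wpM2l// ltW// r0.
  have := ler_norm (Phi i x + r * Phi i f); have := ler_norm (- (Phi i x + - r * Phi i f)).
  rewrite normrN -Pp -Pm {1}Pm {1}Pp => hm hp.
  (* The direction of the move follows the sign of [Phi i x], so that the two contributions do not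
     cancel. *)
  have [x0|x0] := leP 0 (Phi i x).
    exists ((fun t => x t + r * f t), i) => _; split => /=; first exact: cD.
      by move=> t; rewrite addrAC subrr add0r.
    by rewrite -/r; lra.
  exists ((fun t => x t + - r * f t), i) => _; split => /=; first exact: cD.
    by move=> t; rewrite addrAC subrr add0r mulNr normrN.
  by rewrite -/r; lra.
have [G HG] := choice step.
pose x_ := fix x_ n : T -> R := if n is m.+1 then (G (m, x_ m)).1 else fun=> 0.
have cx n : continuous (x_ n).
  elim: n => [|n IH] /=; first exact: cst_continuous.
  by have [] := HG (n, x_ n) IH.
have /choice[x xx] : forall t, exists v : R, forall n, `|v - x_ n t| <= 3 / 2 * (3 ^+ n)^-1.
  by move=> t; apply: geometric_cauchy_limit => n; have [_ /(_ t)] := HG (n, x_ n) (cx n).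
have cx' : continuous x.
  by apply: (continuous_geometric_limit cx) => n t; exact: xx.
have [B HB] := bdP _ cx'.
have [n _ nB] : \forall n \near \oo, B < n%:R by exact: nbhs_infty_gtr.
have {nB} := nB n (leqnn n).
have [_ _] := HG (n, x_ n) (cx n); rewrite -/(x_ n.+1).
set i := (G _).2 => /= ge.
(* The distance from [x] to iterate n+1 is at most 3/2 times 3^-(n+1), which is half of 3^-n. Hence
   [|Phi i x|] is at least [n], against the bound [B < n]. *)
have le : `|Phi i (fun t => x t + -1 * x_ n.+1 t)| <= (3 ^+ n)^-1 / 2 * N i.
  apply: PhiN => [|t]; first exact: cD.
  have := xx t n.+1; rewrite mulN1r exprS invfM.
  by have := r0 n; lra.
have := HB i; rewrite linP// in le.
have := ler_normB (Phi i x) (Phi i x + -1 * Phi i (x_ n.+1)).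
rewrite opprD addrA subrr add0r mulN1r opprK; rewrite mulN1r in le.
lra.
Qed.

End UniformBoundedness.

(** * The variation norm as a dual norm on continuous functions *)

Section Duality.
Context {R : realType} {d : Order.disp_t} {K : orderTopologicalType d} {m0 : K}.
Context (cK : compact [set: K]) (hm0 : forall x : K, (m0 <= x)%O).
Implicit Types (f g h : K -> R) (s t x y : K) (l : seq K).
Implicit Types mu : {finite_measure set (Borel m0) -> \bar R}.

Lemma regular_open_approx mu t e : regular mu -> 0 < e ->
  exists U : set K, [/\ open U, forall x, (x <= t)%O -> U x &
    fine (mu U) <= distrib mu t + e].
Proof.
move=> /(_ _ (lower_Borel t))[_ muE] e0; rewrite /distrib.
have fmu A : measurable A -> mu A \is a fin_num by exact: fin_num_measure.
have := fmu _ (lower_Borel t).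
rewrite muE => /(lb_ereal_inf_adherent e0)[_ [U [oU AU] <-]].
rewrite -muE => UA; exists U; split => //.
have mU := open_Borel (m0 := m0) oU.
rewrite -lee_fin EFinD !fineK ?fmu//; last exact: lower_Borel.
exact: ltW.
Qed.

Lemma integ_le_open mu f (U : set K) : open U -> admissible (m0 := m0) f ->
  (forall x, f x <= 1) -> (forall x, ~ U x -> f x = 0) -> integ mu f <= fine (mu U).
Proof.
move=> oU Af f1 f0; have mU := open_Borel (m0 := m0) oU.
have -> : fine (mu U) = integ mu (\1_(U : set (Borel m0))).
  by rewrite /integ integral_indic ?setIT.
apply: le_Rintegral => //; first exact: integrable_admissible.
- apply: measurable_bounded_integrable => //.
  + by rewrite ltey_eq fin_num_measure.
  + by exists 1; split => // e e1 x _; rewrite /= indicE normr_nat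
      (le_trans _ (ltW e1))// lern1; case: (_ \in _).
- move=> x _; rewrite indicE; have [Ux|nUx] := pselect (U x).
    by rewrite mem_set.
  by rewrite f0// ler0n.
Qed.

Section FixedMeasure.
Context (mp mn : {finite_measure set (Borel m0) -> \bar R}) (F : K -> R).
Context (FE : forall t, F t = distrib mp t - distrib mn t).
Context (rp : regular mp) (rn : regular mn).

(** A Urysohn function for the initial segment at [t] inside [W] and inside open sets that exceed it
    by at most [e] in each measure. Both integrals overshoot by an amount between 0 and [e], so
    their difference is off by at most [e]. *)
Lemma continuous_lower_approx t (W : set K) e : open W ->
  (forall x, (x <= t)%O -> W x) -> 0 < e ->
  exists f, [/\ continuous f, forall x, 0 <= f x <= 1,
    forall x, (x <= t)%O -> f x = 1, forall x, ~ W x -> f x = 0 &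
    `|pairing mp mn f - F t| <= e].
Proof.
move=> oW tW e0.
have [U [oU tU Ue]] := regular_open_approx t rp e0.
have [V [oV tV Ve]] := regular_open_approx t rn e0.
have oUVW : open (U `&` V `&` W) by apply: openI => //; exact: openI.
have [|f [cf f01 f1 f0]] := @urysohn_line R d K `]-oo, t] (~` (U `&` V `&` W)) cK
    (@lray_closed _ _ _) (open_closedC oUVW).
  apply/disjoints_subset => x; rewrite setCK /= in_itv/= => xt.
  by split; [split; [exact: tU|exact: tV]|exact: tW].
have {}f1 x : (x <= t)%O -> f x = 1 by move=> xt; apply: f1; rewrite /= in_itv.
exists f; split => // [x nW|]; first by apply: f0 => -[].
have Af := admissible_continuous (m0 := m0) cK cf.
have lef mu : distrib mu t <= integ mu f.
  rewrite -integ_lower_ind; apply: le_integ => //; first exact: admissible_lower_ind.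
  move=> x; rewrite /lower_ind; case: (leP x t) => [/f1 ->//|_].
  by have /andP[] := f01 x.
have fle1 x : f x <= 1 by have /andP[] := f01 x.
have fU : integ mp f <= fine (mp U) by apply: integ_le_open => // x nU; apply: f0 => -[[]].
have fV : integ mn f <= fine (mn V) by apply: integ_le_open => // x nV; apply: f0 => -[[]].
have := lef mp; have := lef mn; rewrite FE /pairing ler_norml => *.
by apply/andP; split; lra.
Qed.

(** Prescribing the value [c] up to [t] makes the induction work: a function for the tail, constant
    up to [u] with the sign of [F u - F t] as its value, is changed to [c] up to [t] by adding a
    multiple of a cutoff between [t] and [u]. *)
Lemma path_norming_function l t c e : `|c| <= 1 -> path <%O t l -> 0 < e ->
  exists f, [/\ continuous f, forall x, `|f x| <= 1, forall x, (x <= t)%O -> f x = c &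
    c * F t + var_sum F (t :: l) - e <= pairing mp mn f].
Proof.
elim: l t c e => [|u l IH] t c e c1 /=.
  move=> _ e0.
  have [//|f [cf f01 f1 _ fe]] := @continuous_lower_approx t setT e openT _ e0.
  have Af := admissible_continuous (m0 := m0) cK cf.
  exists (fun x => c * f x); split.
  - by move=> x; apply: cvgMr; exact: cf.
  - move=> x; rewrite normrM mulr_ile1//.
    by have /andP[f0 fx1] := f01 x; rewrite ger0_norm.
  - by move=> x /f1 ->; rewrite mulr1.
  - rewrite pairingZ// /var_sum /= big_nil addr0.
    have : `|c * (F t - pairing mp mn f)| <= e.
      by rewrite normrM distrC (le_trans _ fe)// ler_piMl.
    by rewrite ler_norml mulrBr => /andP[_]; lra.
move=> /andP[tu ul] e0; have e20 : 0 < e / 2 by lra.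
pose c1' := Num.sg (F u - F t).
have c1'1 : `|c1'| <= 1 by rewrite normr_sg lern1; case: (_ != _).
have [g [cg g1 gc gE]] := IH u c1' (e / 2) c1'1 ul e20.
(* The cutoff is multiplied by [c - c1'], of absolute value at most 2, so its error is at most
   [e / 2]. *)
have [|||f [cf f01 f1 f0 fe]] := @continuous_lower_approx t `]-oo, u[ (e / 4).
- exact: lray_open.
- by move=> x xt; rewrite /= in_itv/= (le_lt_trans xt).
- by lra.
have Af := admissible_continuous (m0 := m0) cK cf.
have Ag := admissible_continuous (m0 := m0) cK cg.
exists (fun x => g x + (c - c1') * f x); split.
- by move=> x; apply: cvgD; [exact: cg|apply: cvgMr; exact: cf].
- move=> x; have [ux|xu] := leP u x.
    by rewrite f0 ?mulr0 ?addr0//= in_itv/= ltNge ux.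
  rewrite gc; last exact: ltW.
  have /andP[f0x f1x] := f01 x.
  (* Below [u] the new function is a convex combination of [c1'] and [c], so the bound 1
     persists. *)
  rewrite (_ : _ + _ = (1 - f x) * c1' + f x * c); last by lra.
  rewrite (le_trans (ler_normD _ _))// !normrM (ger0_norm f0x) ger0_norm ?subr_ge0//.
  have : (1 - f x) * `|c1'| <= (1 - f x) * 1 by rewrite ler_wpM2l// subr_ge0.
  have : f x * `|c| <= f x * 1 by rewrite ler_wpM2l.
  lra.
- move=> x xt; rewrite gc ?f1//; first by lra.
  by rewrite (le_trans xt)// ltW.
- rewrite pairingD//; last exact: admissibleZ.
  rewrite pairingZ//.
  have : `|(c - c1') * (pairing mp mn f - F t)| <= 2 * (e / 4).
    rewrite normrM ler_pM//.
    by rewrite (le_trans (ler_normB _ _))//; lra.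
  rewrite ler_norml => /andP[+ _].
  have FF : c1' * (F u - F t) = `|F u - F t| by rewrite normrEsg.
  rewrite {1}/var_sum /= big_cons /=.
  move: gE; rewrite /var_sum /= => gE.
  lra.
Qed.

Lemma norming_function l e : sorted <%O l -> 0 < e ->
  exists f, [/\ continuous f, forall x, `|f x| <= 1 &
    `|F m0| + var_sum F l - e <= pairing mp mn f].
Proof.
move=> sl e0.
(* Prepending the minimum does not decrease the variation sum. *)
wlog [l' -> ml'] : l sl / exists2 l', l = m0 :: l' & path <%O m0 l'.
  case: l sl => [|x l] sl H.
    have [//||f [cf f1 fE]] := H [:: m0]; first by exists [::].
    by exists f; split => //; move: fE; rewrite /var_sum/= !big_nil.
  have [xm|xm] := eqVneq x m0; first by apply: H => //; exists l; rewrite -?xm.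
  have mx : (m0 < x)%O by rewrite lt_def xm hm0.
  have [||f [cf f1 fE]] := H (m0 :: x :: l); first by rewrite /= mx.
    by exists (x :: l) => //=; rewrite mx.
  exists f; split => //; apply: le_trans fE; rewrite lerD2r lerD2l.
  by rewrite /var_sum /= big_cons lerDr.
have c1 : `|Num.sg (F m0)| <= 1 by rewrite normr_sg lern1; case: (_ != _).
have [f [cf f1 _ fE]] := path_norming_function c1 ml' e0.
by exists f; split => //; rewrite normrEsg.
Qed.

End FixedMeasure.
End Duality.

(** * Right-isolated points, disjoint cutoffs and the two directions of the criterion *)

Section Criterion.
Context {R : realType} {d : Order.disp_t} {K : orderTopologicalType d} {m0 : K}.
Context (cK : compact [set: K]) (hm0 : forall x : K, (m0 <= x)%O).
Implicit Types (f g h : K -> R) (s t x y : K) (l : seq K).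

(** An open interval around [t] either has a right end [b] beyond [t] or is unbounded on the right;
    in both cases a point strictly between [t] and the smaller bound exists because there is no gap
    after [t]. *)
Lemma not_right_isolated_nbhs t s (A : set K) : ~ right_isolated t -> (t < s)%O ->
  nbhs t A -> exists x, [/\ (t < x)%O, (x < s)%O & A x].
Proof.
move=> /not_orP[_ /forallNP nt] ts; rewrite itv_nbhsE => -[/= i [oi ti] iA].
have between u : (t < u)%O -> exists x, (t < x < u)%O.
  by move=> tu; apply: contrapT => /forallNP H; apply: (nt u).
case: i oi ti iA => [b1 [[] b|[]]] //= oi ti iA.
- have tb : (t < b)%O by move: ti; rewrite in_itv/= => /andP[].
  have [|x /andP[tx]] := between (Order.min b s); first by rewrite lt_min tb.
  rewrite lt_min => /andP[xb xs]; exists x; split => //; apply: iA.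
  move: ti; rewrite /= !in_itv/= xb andbT => /andP[b1t _].
  by case: b1 oi b1t => [[] a|[]] //= _ ?; apply: lt_trans tx.
- by move: oi; case: b1 {ti iA} => [[] a|[]].
- by move: ti; rewrite in_itv/= andbF.
- have [x /andP[tx xs]] := between _ ts; exists x; split => //; apply: iA.
  case: b1 oi ti => [[] a|[]] //= _; rewrite !in_itv//= !andbT => ti.
  exact: lt_trans ti tx.
Qed.

(** Across the gap after [t] a Urysohn function takes only the values 1 and 0, so it is the
    indicator itself. *)
Lemma right_isolated_continuous t : right_isolated t ->
  continuous (lower_ind t : K -> R).
Proof.
case=> [tmax|[s [ts nts]]].
  rewrite (_ : lower_ind t = cst 1); first exact: cst_continuous.
  by apply/funext => x; rewrite /lower_ind tmax.
have [f [cf _ f1 f0]] := @urysohn_lt R _ _ _ _ cK ts.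
rewrite (_ : lower_ind t = f)//; apply/funext => x; rewrite /lower_ind.
have [/f1 ->//|tx] := leP x t; rewrite f0//.
by rewrite leNgt; apply/negP => xs; apply: (nts x); rewrite tx.
Qed.

(* The functions [lower_ind t - phi t] have disjoint supports. *)
Lemma disjoint_cutoffs l : sorted <%O l -> exists phi : K -> K -> R,
  (forall t, continuous (phi t)) /\
  forall a : K -> R, (forall t, `|a t| <= 1) -> forall x,
    `|\sum_(t <- l) a t * (lower_ind t x + -1 * phi t x)| <= 1 /\
    ((forall t, t \in l -> (x <= t)%O) ->
      \sum_(t <- l) a t * (lower_ind t x + -1 * phi t x) = 0).
Proof.
elim: l => [_|t l IH tl].
  exists (fun _ _ => 0); split=> [t|a _ x]; first exact: cst_continuous.
  by rewrite big_nil normr0.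
have [phi [cphi phiP]] := IH (path_sorted tl).
have tl' u : u \in l -> (t < u)%O.
  by move=> ul; have /allP/(_ _ ul) := order_path_min lt_trans tl.
(* The cutoff [v] falls from 1 at [t] to 0 at the next point of the list; after the last point it is
   constantly 1. *)
have [v [cv v01 v1 v0]] : exists v : K -> R, [/\ continuous v, forall x, 0 <= v x <= 1,
    forall x, (x <= t)%O -> v x = 1 &
    forall x, ~ (forall u, u \in l -> (x <= u)%O) -> v x = 0].
  case: l tl tl' {IH phiP} => [|u l] /= tl tl'.
    exists (cst 1); split => // [|x|x []//]; first exact: cst_continuous.
    by rewrite ler01 lexx.
  have [v [cv v01 v1 v0]] := @urysohn_lt R _ _ _ _ cK (tl' u (mem_head _ _)).
  exists v; split => // x nx; apply: v0; rewrite leNgt; apply/negP => xu.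
  apply: nx => w; rewrite inE => /predU1P[->|wl]; first exact: ltW.
  move: tl => /andP[_ ul].
  by have /allP/(_ _ wl)/(lt_trans xu)/ltW := order_path_min lt_trans ul.
exists (fun u => if u == t then v else phi u); split=> [u|a a1 x].
  by case: ifP.
have -> : \sum_(u <- t :: l) a u * (lower_ind u x + -1 * (if u == t then v else phi u) x)
    = a t * (lower_ind t x + -1 * v x) + \sum_(u <- l) a u * (lower_ind u x + -1 * phi u x).
  rewrite big_cons eqxx; congr (_ + _); apply: eq_big_seq => u ul.
  by have := tl' _ ul; rewrite lt_def => /andP[/negbTE -> _].
have [S1 S0] := phiP a a1 x.
have /andP[v0x v1x] := v01 x.
have lt1 : (x <= t)%O -> lower_ind t x + -1 * v x = 0.
  by move=> xt; rewrite v1// /lower_ind xt /=; lra.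
(* Before all points of [l] the tail sum vanishes by induction; past one of them the new term
   vanishes. At most one term is nonzero at each point. *)
have [xl|nxl] := pselect (forall u, u \in l -> (x <= u)%O).
  rewrite S0// addr0; split; last by move=> H; rewrite lt1 ?mulr0// H// mem_head.
  have [xt|tx] := leP x t; first by rewrite lt1// mulr0 normr0.
  rewrite normrM mulr_ile1// /lower_ind [(x <= t)%O]leNgt tx add0r mulN1r normrN ger0_norm//.
have nxt : ~ (x <= t)%O.
  by move=> xt; apply: nxl => u /tl'/ltW; exact: le_trans.
rewrite v0// mulr0 addr0 /lower_ind (negbTE (introN idP nxt)) mulr0 add0r; split => // H.
by exfalso; apply: nxt; apply: H; exact: mem_head.
Qed.

Lemma sum_zip1_le (G : K -> R) t l : (forall s, 0 <= G s) ->
  \sum_(p <- zip (t :: l) l) G p.1 <= \sum_(s <- t :: l) G s.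
Proof.
move=> G0; elim: l t => [|u l IH] t; first by rewrite big_nil big_cons big_nil addr0.
by rewrite /= big_cons [leRHS]big_cons lerD2l; exact: IH.
Qed.

Section FixedMeasure.
Context (mp mn : {finite_measure set (Borel m0) -> \bar R}) (F : K -> R).
Context (FE : forall t, F t = distrib mp t - distrib mn t).

(** With [a t] the sign of [F t] minus the pairing with [phi t], the combination bounded by 1 pairs
    to the sum of the absolute values of these differences. *)
Lemma sum_normr_le l (phi : K -> K -> R) (B : R) : (forall t, continuous (phi t)) ->
  (forall a : K -> R, (forall t, `|a t| <= 1) -> forall x,
    `|\sum_(t <- l) a t * (lower_ind t x + -1 * phi t x)| <= 1) ->
  (bv_norm m0 F <= B%:E)%E ->
  \sum_(t <- l) `|F t| <= B + \sum_(t <- l) `|pairing mp mn (phi t)|.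
Proof.
move=> cphi phiP FB.
pose a t := Num.sg (F t - pairing mp mn (phi t)).
have a1 t : `|a t| <= 1 by rewrite normr_sg lern1; case: (_ != _).
have Aphi t : admissible (m0 := m0) (phi t) by exact: admissible_continuous.
have Ai t : admissible (R := R) (m0 := m0) (lower_ind t) by exact: admissible_lower_ind.
have Ad t : admissible (m0 := m0) (fun x => lower_ind t x + -1 * phi t x).
  by apply: admissibleD => //; exact: admissibleZ.
have [AS pS] := admissible_pairing_sum mp mn l a Ad.
have := normr_pairing_le FE cK hm0 AS (phiP a a1) FB.
rewrite mul1r pS => /(le_trans (ler_norm _)) Sle.
rewrite -lerBlDr -sumrB; apply: le_trans Sle; apply: ler_sum => t _.
rewrite pairingD//; last exact: admissibleZ.
rewrite pairingZ// (pairing_lower_ind FE) mulN1r -normrEsg.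
exact: lerB_dist.
Qed.

End FixedMeasure.

Section Family.
Context {I : Type} {F : I -> K -> R}.
Context (mup mun : I -> {finite_measure set (Borel m0) -> \bar R}).
Context (HFmu : forall i t, F i t = distrib (mup i) t - distrib (mun i) t).
Local Notation L i := (pairing (mup i) (mun i)).

Lemma weak_null_bounded :
  (forall i, NBV (F i)) -> (forall i, regular (mup i) /\ regular (mun i)) ->
  (forall f, continuous f -> c0lim (fun i => L i f)) ->
  exists M : R, forall i, (bv_norm m0 (F i) <= M%:E)%E.
Proof.
move=> HF Hreg wn.
have fin i : bv_norm m0 (F i) \is a fin_num.
  have [_ vF] := HF i; rewrite /bv_norm fin_numD fin_num_abs/= ltry/= ge0_fin_numE//.
  by apply: ereal_sup_ubound; exists [::] => //; rewrite /var_sum big_nil.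
pose N i := fine (bv_norm m0 (F i)).
have NE i : bv_norm m0 (F i) = (N i)%:E by rewrite fineK.
have A f : continuous f -> admissible (m0 := m0) f := admissible_continuous cK.
have [|i f c cf fc|i r rN|f cf|M HM] := @uniform_boundedness R K I (fun i => L i) N.
- move=> i f g k /A Af /A Ag; rewrite pairingD ?pairingZ//; exact: admissibleZ.
- by apply: (normr_pairing_le (HFmu i) cK hm0 (A _ cf) fc); rewrite NE.
(* The gap from [r] to the norm is halved: one half for the choice of the partition, one for the
   error of the norming function. *)
- have : ~ (bv_norm m0 (F i) <= ((r + N i) / 2)%:E)%E.
    by rewrite NE lee_fin; apply/negP; rewrite -ltNge; lra.
  move/bv_normP/existsNP => [l /not_implyP[sl /negP]]; rewrite -ltNge => rl.
  have e0 : 0 < (N i - r) / 2 by lra.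
  have [rp rn] := Hreg i.
  have [f [cf f1 fE]] := norming_function cK hm0 (HFmu i) rp rn sl e0.
  by exists f; split => //; lra.
- by have [B HB] := c0lim_bounded (wn f cf); exists B.
- by exists M => i; rewrite NE lee_fin.
Qed.

(** The correction in c_0 is the sum of the absolute pairings with the cutoffs; [|M|] is nonnegative
    even for an empty family. *)
Lemma weak_null_sum_bounded (M : R) :
  (forall f, continuous f -> c0lim (fun i => L i f)) ->
  (forall i, (bv_norm m0 (F i) <= M%:E)%E) ->
  forall S : seq K, uniq S ->
    le_mod_c0 (fun i => \sum_(t <- S) `|F i t|) (fun _ => `|M|).
Proof.
move=> wn FM S uS; pose l := sort <=%O S.
have sl : sorted <%O l by rewrite lt_sorted_uniq_le sort_uniq uS sort_le_sorted.
have [phi [cphi phiP]] := disjoint_cutoffs sl.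
exists (fun i => \sum_(t <- l) `|L i (phi t)|); split.
  by apply: c0lim_sum => t _; apply: c0lim_norm; exact: wn.
move=> i; rewrite -(perm_big _ (permEl (perm_sort <=%O S)))/=.
have phi1 (a : K -> R) : (forall t, `|a t| <= 1) -> forall x,
    `|\sum_(t <- l) a t * (lower_ind t x + -1 * phi t x)| <= 1.
  by move=> a1 x; have [] := phiP a a1 x.
apply: le_trans (sum_normr_le (HFmu i) cphi phi1 (FM i)) _.
by rewrite lerD2r ler_norm.
Qed.

Lemma weak_null_of_bounds (M k : R) :
  (forall i, (bv_norm m0 (F i) <= M%:E)%E) ->
  (forall t : K, right_isolated t -> c0lim (fun i => F i t)) -> 0 <= k ->
  (forall S : seq K, uniq S ->
    le_mod_c0 (fun i => \sum_(t <- S) `|F i t|) (fun _ => k)) ->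
  forall f, continuous f -> c0lim (fun i => L i f).
Proof.
move=> FM iso0 k0 sumk f cf; apply: c0lim_approx => e e0.
(* With mesh [r = e / D], the staircase error [r * |M|] and the small increments [2 * r * k]
   together stay below [e]. *)
pose D := `|M| + 2 * k + 1; have D0 : 0 < D by rewrite /D; have := normr_ge0 M; lra.
pose r := e / D; have r0 : 0 < r by exact: divr_gt0.
have Dr : r * `|M| + 2 * r * k <= e.
  have : r * D = e by rewrite /r divfK// gt_eqF.
  by rewrite /D; lra.
have [l [ml lmax fst fp]] := regulated_partition cK hm0 (regulated_continuous cK cf) r0.
have um : uniq (m0 :: l) by apply: (sorted_uniq lt_trans ltxx).
have [z [cz Hz]] := sumk _ um.
pose jump p := `|f p.2 - f p.1|.
(* These are the terms of the Abel sum that condition (b) sends to 0. *)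
pose v p i := if `[< right_isolated p.1 >] then jump p * F i p.1 else 0.
have cv p : c0lim (v p).
  rewrite /v; case: asboolP => [ip|_]; last exact: c0lim0.
  exact: c0limZ (iso0 _ ip).
have jumpP p i : p \in zip (m0 :: l) l ->
    `|(f p.2 - f p.1) * F i p.1| <= 2 * r * `|F i p.1| + `|v p i|.
  move=> pl; rewrite /v normrM -/(jump p); case: asboolP => [ip|nip].
    by rewrite normrM /jump normr_id lerDr mulr_ge0//; lra.
  rewrite normr0 addr0 ler_wpM2r//.
  have [p12 _] := path_lt_zip ml pl.
  have : nbhs p.1 [set x | `|f p.1 - f x| < r].
    by have /cvgrPdist_lt/(_ _ r0) := cf p.1.
  (* A point [x] just after [p.1] splits the increment: [f] changes by less than [r] up to [x] by
     continuity, and by at most [r] from [x] to [p.2] by the choice of the partition. *)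
  move=> /(not_right_isolated_nbhs nip p12)[x [p1x xp2 /= fx]].
  have := fp _ pl _ p1x (ltW xp2); have := ler_normD (f p.1 - f x) (f x - f p.2).
  rewrite addrA subrK /jump distrC; lra.
have lastiso : right_isolated (last m0 l) by left.
exists (fun i => 2 * r * z i +
    (`|f (last m0 l)| * `|F i (last m0 l)| + \sum_(p <- zip (m0 :: l) l) `|v p i|)).
  apply: c0limD; first exact: c0limZ.
  apply: c0limD; first by apply: c0limZ; apply: c0lim_norm; exact: iso0.
  by apply: c0lim_sum => p _; exact: c0lim_norm.
move=> i.
have Af : admissible (m0 := m0) f by exact: admissible_continuous.
have [As ps] := admissible_pairing_staircase (HFmu i) f m0 l.
have As' := admissibleZ (-1) As.
have Ad := admissibleD Af As'.
have fst' x : `|f x + -1 * staircase f m0 l x| <= r by rewrite mulN1r.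
have := normr_pairing_le (HFmu i) cK hm0 Ad fst' (FM i).
rewrite pairingD// pairingZ// ps riemann_sum_abel mulN1r.
set a := f _ * _; set b := \sum_(p <- _) _ => Lab.
have aE : `|a| = `|f (last m0 l)| * `|F i (last m0 l)| by rewrite normrM.
have bE : `|b| <= 2 * r * (k + z i) + \sum_(p <- zip (m0 :: l) l) `|v p i|.
  apply: (le_trans (ler_norm_sum _ _ _)).
  apply: (@le_trans _ _ (\sum_(p <- zip (m0 :: l) l) (2 * r * `|F i p.1| + `|v p i|))).
    by rewrite big_seq [leRHS]big_seq; apply: ler_sum => p /jumpP.
  rewrite big_split lerD2r /= -mulr_sumr ler_wpM2l//; first by rewrite mulr_ge0// ltW.
  apply: le_trans (Hz i).
  exact: (@sum_zip1_le (fun s => `|F i s|)).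
have rM : r * M <= r * `|M| by rewrite ler_wpM2l ?ler_norm// ltW.
have := ler_normD (L i f - (a - b)) (a - b); rewrite subrK.
have := ler_normB a b; rewrite -aE; move: bE; rewrite mulrDr.
lra.
Qed.

End Family.
End Criterion.

(* K : compact line with minimum m0; F i = F_{mu_i} where the finite signed
   regular Borel measure mu_i is written as mup i - mun i (Jordan-type
   decomposition into finite regular Borel measures). *)
Theorem theorem2p28 (R : realType) (d : Order.disp_t) (K : orderTopologicalType d)
  (m0 : K) (hm0 : forall t : K, (m0 <= t)%O) (hK : compact [set: K])
  (I : Type) (F : I -> K -> R)
  (mup mun : I -> {finite_measure set Borel m0 -> \bar R})
  (HF : forall i, NBV (F i))
  (Hreg : forall i, regular (mup i) /\ regular (mun i))
  (HFmu : forall i t, F i t = distrib (mup i) t - distrib (mun i) t) :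
  (forall f : K -> R, continuous f ->
     c0lim (fun i => integ (mup i) f - integ (mun i) f))
  <->
  [/\ exists M : R, forall i, (bv_norm m0 (F i) <= M%:E)%E,
      forall t : K, right_isolated t -> c0lim (fun i => F i t)
    & exists k : R, 0 <= k /\
        forall S : seq K, uniq S ->
          le_mod_c0 (fun i => \sum_(t <- S) `|F i t|) (fun _ => k)].
Proof.
split=> [wn|[[M FM] iso0 [k [k0 sumk]]]].
  have [M FM] := weak_null_bounded hK hm0 HFmu HF Hreg wn.
  split; first by exists M.
    move=> t it; rewrite (_ : (fun i => F i t) =
      (fun i => pairing (mup i) (mun i) (lower_ind t))).
      by apply: wn; exact: right_isolated_continuous.
    by apply/funext => i; rewrite (pairing_lower_ind (HFmu i)).
  by exists `|M|; split => //; exact: (weak_null_sum_bounded hK hm0 HFmu wn FM).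
exact: (weak_null_of_bounds hK hm0 HFmu FM iso0 k0 sumk).
Qed.
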